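(* Assume [H1], [H2] and [H3] (stated in the context), and let $(L_n)_{n\ge0}$ be the operators defined in the context. There exists a collection of functions $(\mu_n)_{n\ge0}$ in $\mathcal{C}^\infty(\mathbb{T}^d,\mathbb{R})$ such that $\mu_0=\rho$, $\int_{\mathbb{T}^d}\mu_n(x)\,\mathrm{d}x=0$ for $n\ge1$, and for all $n\ge0$ $$L_0^*\mu_n=-\sum_{\ell=1}^n(L_\ell)^*\mu_{n-\ell}.$$ Moreover, let $N\ge0$ and $\tau_0>0$ be fixed, and let $L^{(N)}(\tau;x,\partial_x)=L(x,\partial_x)+\sum_{n=1}^N\tau^nL_n(x,\partial_x)$. Then the function $$\mu^{(N)}(\tau;x)=\rho(x)+\sum_{n=1}^N\tau^n\mu_n(x)\in\mathcal{C}^\infty(\mathbb{T}^d,\mathbb{R})$$ satisfies $\int_{\mathbb{T}^d}\mu^{(N)}(\tau;x)\,\mathrm{d}x=1$ and $$L^{(N)}(\tau;x,\partial_x)^*\mu^{(N)}(\tau;x)=G^{(N)}(\tau;x),$$ where for all $k\in\mathbb{N}$ and all $\tau\in[0,\tau_0]$, $$\|G^{(N)}(\tau;\cdot)\|_{\mathcal{C}^k}\le C_{N,k}\,\tau^{N+1}\qquad\text{and}\qquad\int_{\mathbb{T}^d}G^{(N)}(\tau;x)\,\mathrm{d}x=0,$$ with a constant $C_{N,k}$ depending on $N$ and $k$ (and possibly on $\tau_0$, $f$, $\sigma$), but not on $\tau$.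
   Context: Smooth means $\mathcal{C}^\infty$. On the $d$-dimensional torus $\mathbb{T}^d$ consider the SDE $\mathrm{d}X^i(t)=f^i(X(t))\,\mathrm{d}t+\sum_{\ell=1}^m\sigma^i_\ell(X(t))\,\mathrm{d}W^\ell(t)$, $i=1,\dots,d$, where $f=(f^i)$ and $\sigma=(\sigma^i_\ell)$ are smooth on $\mathbb{T}^d$ (periodic), and $W=(W^1,\dots,W^m)$ is a standard $m$-dimensional Wiener process. Generator (summation over repeated indices): $Lv(x)=f^i(x)\partial_iv(x)+a^{ij}(x)\partial_{ij}v(x)$, with $a^{ij}(x)=\frac12\sum_{\ell=1}^m\sigma^i_\ell(x)\sigma^j_\ell(x)$. For a differential operator $B$, $B^*$ is its adjoint with respect to the $L^2(\mathbb{T}^d,\mathrm{d}x)$ product. For smooth $\varphi$, $u(t,x)$ is the unique solution of $\partial_tu=Lu$, $u(0,x)=\varphi(x)$. Norms: $\|\psi\|_{\mathcal{C}^k}=\sup_{|\boldsymbol{j}|\le k}\sup_{x\in\mathbb{T}^d}|\partial_{\boldsymbol{j}}\psi(x)|$ (multi-indices $\boldsymbol{j}\in\mathbb{N}^d$). Standing hypotheses: [H1] There exists $\rho\in\mathcal{C}^\infty(\mathbb{T}^d,\mathbb{R})$, $\rho\ge0$, with $L^*\rho=0$ and $\int_{\mathbb{T}^d}\rho\,\mathrm{d}x=1$. [H2] For every $g\in\mathcal{C}^\infty(\mathbb{T}^d,\mathbb{R})$ with $\int_{\mathbb{T}^d}g\,\mathrm{d}x=0$ there exists a unique $\mu\in\mathcal{C}^\infty(\mathbb{T}^d,\mathbb{R})$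 with $L^*\mu=g$ and $\int_{\mathbb{T}^d}\mu(x)\rho(x)\,\mathrm{d}x=0$. [H3] There exist a constant $\lambda>0$ and, for each $k\in\mathbb{N}$, a polynomial $p_k(t)$ such that for every $\varphi\in\mathcal{C}^\infty(\mathbb{T}^d,\mathbb{R})$ with $\int_{\mathbb{T}^d}\varphi\rho\,\mathrm{d}x=0$, $\|u(t,\cdot)\|_{\mathcal{C}^k}\le p_k(t)e^{-\lambda t}\|\varphi\|_{\mathcal{C}^k}$ for all $t\ge0$. One Euler step from $x\in\mathbb{T}^d$: $\tilde X^i_x(\tau)=x^i+\tau f^i(x)+\sigma^i_\ell(x)W^\ell(\tau)$ (point taken in $\mathbb{T}^d$). Operators $A_n$: these are the differential operators of order $2n$ with smooth coefficients giving the expansion $\mathbb{E}\,\varphi(\tilde X_x(\tau))=\sum_{n=0}^N\tau^nA_n\varphi(x)+O(\tau^{N+1})$ for all smooth $\varphi$ and all $N$. Explicitly, for $y\in\mathbb{T}^d$ let $\mathcal{L}_y=f^i(y)\partial_i+a^{ij}(y)\partial_{ij}$ (constant coefficients frozen at $y$); then $(A_n\varphi)(x)=\frac1{n!}\big((\mathcal{L}_x)^n\varphi\big)(x)$. So $A_0=\mathrm{Id}$, $A_1=L$. Operators $L_n$ (modified generator coefficients): $L_0=L$ and, recursively for $n\ge1$, $$L_n=A_{n+1}+\sum_{\ell=1}^n\frac{B_\ell}{\ell!}\sum_{n_1+\cdots+n_\ell+n_{\ell+1}=n-\ell}L_{n_1}\cdots L_{n_\ell}A_{n_{\ell+1}+1},$$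 with integers $n_i\ge0$ and $B_\ell$ the Bernoulli numbers, $\frac{z}{e^z-1}=\sum_{\ell\ge0}\frac{B_\ell}{\ell!}z^\ell$ (so $B_1=-\frac12$). *)

(* Defs.v *)
From HB Require Import structures.
From mathcomp Require Import all_boot all_order all_algebra.
From mathcomp Require Import all_classical all_reals all_analysis.
Set Implicit Arguments.
Unset Strict Implicit.
Unset Printing Implicit Defensive.
Import Order.TTheory GRing.Theory Num.Theory.
Import numFieldNormedType.Exports.
Local Open Scope classical_set_scope.
Local Open Scope ring_scope.

(* The torus T^d is R^d/Z^d: a function on T^d is a function on 'rV[R]_d that
   has period 1 in each coordinate. *)
Definition rfun (R : realType) (d : nat) := 'rV[R]_d -> R.
Definition operator (R : realType) (d : nat) := rfun R d -> rfun R d.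

Section Torus.
Context {R : realType} {d : nat}.
Implicit Types (g h phi psi : rfun R d) (x : 'rV[R]_d).

Definition pderiv (i : 'I_d) : operator R d :=
  fun g x => 'D_(delta_mx 0 i) g x.

Definition pderivs (s : seq 'I_d) : operator R d :=
  fun g => foldr pderiv g s.

Definition smooth g : Prop :=
  forall s : seq 'I_d, continuous (pderivs s g) /\
    forall (i : 'I_d) x, derivable (pderivs s g) x (delta_mx 0 i).

Definition periodic g : Prop :=
  forall (i : 'I_d) x, g (x + delta_mx 0 i) = g x.

Definition smooth_torus g : Prop := periodic g /\ smooth g.

Definition mderiv (j : 'I_d -> nat) : operator R d :=
  fun g => foldr (fun i h => iter (j i) (pderiv i) h) g (enum 'I_d).

(* The supremum is taken in \bar R, so that no boundedness is presupposed. *)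
Definition Cnorm (k : nat) (psi : rfun R d) : \bar R :=
  ereal_sup [set y | exists (j : 'I_d -> nat) (x : 'rV[R]_d),
    (\sum_(i < d) j i <= k)%N /\ y = (`|mderiv j psi x|)%:E].

End Torus.

(* The integral over the unit cube [0,1]^d, a fundamental domain of Z^d, as an
   iterated Lebesgue integral. *)
Fixpoint torus_int {R : realType} {d : nat} : rfun R d -> R :=
  match d return rfun R d -> R with
  | 0%N => fun g => g 0
  | d'.+1 => fun g =>
      (\int[lebesgue_measure]_(t in `[0%R, 1%R])
        torus_int (fun y : 'rV[R]_d' => g (row_mx (const_mx t : 'rV[R]_1) y)))%R
  end.

Section Adjoint.
Context {R : realType} {d : nat}.
Implicit Types (phi psi g : rfun R d) (B : operator R d).

Definition inner (phi psi : rfun R d) : R :=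
  torus_int (fun x => phi x * psi x).

Definition is_adjoint_at B psi g : Prop := smooth_torus g /\
  forall phi, smooth_torus phi -> inner (B phi) psi = inner phi g.

(* B^* psi is the smooth g such that <B phi, psi> = <phi, g> for all smooth
   phi. At most one such g exists, and it exists for every differential
   operator B with smooth coefficients and every smooth psi (integration by
   parts); the default value is only for the other cases. *)
Definition adjoint B : operator R d :=
  fun psi => xget (fun=> 0) [set g | is_adjoint_at B psi g].

Lemma adjointP B psi g :
  is_adjoint_at B psi g -> is_adjoint_at B psi (adjoint B psi).
Proof. by move=> Bg; apply: (@xgetPex _ _ (is_adjoint_at B psi)); exists g. Qed.

End Adjoint.

(* B_l is given by its generating function z / (e^z - 1), near z = 0. *)
Definition bernoulli_numbers {R : realType} (B : nat -> R) : Prop :=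
  \forall z \near (0 : R)^',
    series (fun l => B l / l`!%:R * z ^+ l) @ \oo --> z / (expR z - 1).

Section Generator.
Context {R : realType} {d m : nat}.
Variables (f : 'I_d -> rfun R d) (sigma : 'I_d -> 'I_m -> rfun R d).

Definition diffusion (i j : 'I_d) : rfun R d :=
  fun x => 2^-1 * \sum_(l < m) sigma i l x * sigma j l x.

Definition generator : operator R d := fun v x =>
  \sum_(i < d) f i x * pderiv i v x
  + \sum_(i < d) \sum_(j < d) diffusion i j x * pderiv i (pderiv j v) x.

Definition frozen_generator (y : 'rV[R]_d) : operator R d := fun v x =>
  \sum_(i < d) f i y * pderiv i v x
  + \sum_(i < d) \sum_(j < d) diffusion i j y * pderiv i (pderiv j v) x.

(* The coefficient of tau^n in E phi(x + tau f(x) + sigma(x) W(tau)), which is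
   (e^(tau L_x) phi)(x) for L_x the generator with coefficients frozen at x. *)
Definition euler_op (n : nat) : operator R d := fun phi x =>
  n`!%:R^-1 * iter n (frozen_generator x) phi x.

Definition compose_ops (l : nat) (F : 'I_l -> operator R d) : operator R d :=
  \big[(fun P Q : operator R d => P \o Q)/idfun]_(i < l) F i.

(* The right-hand side of the recursion for L_n, n >= 1. The tuple
   (n_1, ..., n_(l+1)) is k, with n_i = k (i - 1); the bound k i <= n follows
   from the condition on the sum, which even forces k i < n. *)
Definition modified_step (B : nat -> R) (L : nat -> operator R d) (n : nat) :
    operator R d := fun phi x =>
  euler_op n.+1 phi x
  + \sum_(1 <= l < n.+1) B l / l`!%:R *
      \sum_(k : {ffun 'I_l.+1 -> 'I_n.+1} | (\sum_i k i == n - l)%N)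
        compose_ops (fun i : 'I_l => L (k (widen_ord (leqnSn l) i)))
          (euler_op (k ord_max).+1 phi) x.

(* The list [:: L_0; ...; L_n]. *)
Fixpoint modified_ops (B : nat -> R) (n : nat) : seq (operator R d) :=
  match n with
  | 0%N => [:: generator]
  | n'.+1 => let s := modified_ops B n' in
             rcons s (modified_step B (nth generator s) n'.+1)
  end.

Definition modified_op (B : nat -> R) (n : nat) : operator R d :=
  nth generator (modified_ops B n) n.

Lemma size_modified_ops B n : size (modified_ops B n) = n.+1.
Proof. by elim: n => //= n IHn; rewrite size_rcons IHn. Qed.

Lemma nth_modified_ops B n i : (i <= n)%N ->
  nth generator (modified_ops B n) i = modified_op B i.
Proof.
elim: n => [|n IHn]; first by rewrite leqn0 => /eqP ->.
rewrite leq_eqVlt => /predU1P[-> //|lt_in].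
by rewrite /= nth_rcons size_modified_ops lt_in IHn.
Qed.

Lemma modified_op0 B : modified_op B 0 = generator.
Proof. by []. Qed.

Lemma modified_opS B n : (0 < n)%N ->
  modified_op B n = modified_step B (modified_op B) n.
Proof.
case: n => // n _.
rewrite {1}/modified_op /= nth_rcons size_modified_ops ltnn eqxx.
apply/funext => phi; apply/funext => x; rewrite /modified_step.
congr (_ + _); rewrite big_nat_cond [RHS]big_nat_cond.
apply: eq_bigr => l /andP[/andP[l_gt0 _] _]; congr (_ * _).
apply: eq_bigr => k /eqP k_sum; rewrite /compose_ops.
rewrite (eq_bigr (fun i : 'I_l => modified_op B (k (widen_ord (leqnSn l) i)))) //= => i _.
rewrite nth_modified_ops //.
apply: (@leq_trans (\sum_j k j)%N); first by rewrite (bigD1 (widen_ord _ i)) ?leq_addr.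
by rewrite k_sum; case: l l_gt0 {k k_sum i} => // l _; rewrite subSS leq_subr.
Qed.

Definition truncated_op (B : nat -> R) (N : nat) (tau : R) : operator R d :=
  fun phi x => generator phi x
    + \sum_(1 <= n < N.+1) tau ^+ n * modified_op B n phi x.

(* Classical solutions of d_t u = L u, u(0) = phi; by the maximum principle
   there is at most one up to its values at t < 0, so that quantifying over all
   of them, as H3 does, is to speak of the solution. *)
Definition kolmogorov_solution (phi : rfun R d) (u : R -> rfun R d) : Prop :=
  [/\ u 0 = phi,
      forall t, 0 <= t -> smooth_torus (u t),
      {within [set p : R * 'rV[R]_d | 0 <= p.1],
         continuous (fun p => u p.1 p.2)} &
      forall (t : R) (x : 'rV[R]_d), 0 < t ->
        is_derive t 1 (u ^~ x) (generator (u t) x)].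

Definition H1 (rho : rfun R d) : Prop :=
  [/\ smooth_torus rho, forall x, 0 <= rho x,
      adjoint generator rho = (fun=> 0) & torus_int rho = 1].

Definition H2 (rho : rfun R d) : Prop :=
  forall g, smooth_torus g -> torus_int g = 0 ->
    exists! mu : rfun R d, [/\ smooth_torus mu, adjoint generator mu = g &
                               torus_int (fun x => mu x * rho x) = 0].

Definition H3 (rho : rfun R d) : Prop :=
  exists2 lambda : R, 0 < lambda & exists p : nat -> {poly R},
    forall k phi, smooth_torus phi ->
      torus_int (fun x => phi x * rho x) = 0 ->
    forall u, kolmogorov_solution phi u ->
    forall t, 0 <= t ->
      (Cnorm k (u t) <= ((p k).[t] * expR (- lambda * t))%:E * Cnorm k phi)%E.

End Generator.

Definition truncated_density {R : realType} {d : nat} (rho : rfun R d)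
    (mu : nat -> rfun R d) (N : nat) (tau : R) : rfun R d :=
  fun x => rho x + \sum_(1 <= n < N.+1) tau ^+ n * mu n x.

(* Main.v *)
(* Everything rests on the solvability of L^* mu = g for mean-zero g (H2): the
   right-hand side of the recursion has mean zero because every L_l kills
   constants, being a sum of compositions whose innermost factor is some A_n with
   n >= 1; and mu is then made mean zero by subtracting a multiple of rho. In the
   product of the sums of tau^l L_l^* and of tau^k mu_k, the recursion cancels
   all the terms with l + k <= N, and the finitely many others are at most
   tau^(N+1) times a constant on [0, tau0], the torus being compact.

   That adjoints exist is integration by parts: the class of operators that
   preserve smooth functions and have an adjoint on them contains partial
   derivatives and multiplications by smooth functions, and is closed under sums
   and compositions. *)
Require Import Defs.
From mathcomp Require Import all_boot all_order all_algebra.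
From mathcomp Require Import all_classical all_reals all_analysis.
From mathcomp Require Import ring lra.
Import Order.TTheory GRing.Theory Num.Theory.
Import numFieldNormedType.Exports.
Local Open Scope classical_set_scope.
Local Open Scope ring_scope.

Set Implicit Arguments.
Unset Strict Implicit.
Unset Printing Implicit Defensive.

(** * Integration over the torus *)

(** Closed, with both of every pair of identified faces, so that it is compact. *)
Definition unit_cube (R : realType) (d : nat) : set 'rV[R]_d :=
  [set x | forall i, x ord0 i \in `[0, 1]].

Definition slice (R : realType) (d : nat) (g : rfun R d.+1) (t : R) : rfun R d :=
  fun y => g (row_mx (const_mx t : 'rV[R]_1) y).

Lemma compact_unit_cube (R : realType) (d : nat) : compact (@unit_cube R d).
Proof.
apply: (@rV_compact R d (fun=> `[0, 1]%classic)) => i.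
exact: segment_compact.
Qed.

(** Balls of row vectors are products of balls of the coordinates, and finitely many neighbourhoods
    intersect in a neighbourhood. *)
Lemma continuous_rV (R : realType) (d : nat) (T : topologicalType)
    (F : T -> 'rV[R]_d) :
  (forall i, continuous (fun x => F x ord0 i)) -> continuous F.
Proof.
move=> Fc x; apply/cvg_ballP => e e0.
have : \forall y \near x, forall j, ball (F x ord0 j) e (F y ord0 j).
  by apply: filter_forall => j; have /cvg_ballP := Fc j x; apply.
by apply: filterS => y Fxy; split=> // i j; rewrite ord1.
Qed.

Lemma continuous_row_mx_const (R : realType) (d : nat) :
  continuous (fun p : R * 'rV[R]_d =>
    row_mx (const_mx p.1 : 'rV[R]_1) p.2 : 'rV[R]_d.+1).
Proof.
apply: continuous_rV => i; rewrite -(splitK (i : 'I_(1 + d))).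
case: (fintype.split _) => j /=.
  under eq_fun do rewrite (row_mxEl (const_mx _ : 'rV[R]_1)) mxE.
  by move=> p; exact: cvg_fst.
under eq_fun do rewrite (row_mxEr (const_mx _ : 'rV[R]_1)).
have coordc : continuous (fun x : 'rV[R]_d => x ord0 j).
  exact: coord_continuous.
move=> p; exact: (continuous_comp (f := snd) cvg_snd (coordc _)).
Qed.

Lemma continuous_uncurry_slice (R : realType) (d : nat) (g : rfun R d.+1) :
  continuous g -> continuous (fun p : R * 'rV[R]_d => slice g p.1 p.2).
Proof.
move=> gc p.
exact: (continuous_comp (@continuous_row_mx_const R d p) (gc _)).
Qed.

Lemma continuous_slice (R : realType) (d : nat) (g : rfun R d.+1) (t : R) :
  continuous g -> continuous (slice g t).
Proof.
move=> gc y.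
have pairc : (t, z) @[z --> y] --> (t, y).
  by apply: (@cvg_pair _ _ _ (nbhs y) (nbhs t) (nbhs y)); [exact: cvg_cst|].
exact: (@cvg_comp _ _ _ (fun z => (t, z)) (fun p => slice g p.1 p.2) _ _ _ pairc
  (@continuous_uncurry_slice R d g gc (t, y))).
Qed.

Lemma unit_cube_row_mx (R : realType) (d : nat) (t : R) (y : 'rV[R]_d) :
  unit_cube (row_mx (const_mx t : 'rV[R]_1) y) <->
  t \in `[0, 1] /\ unit_cube y.
Proof.
split=> [cube_ty|[t01 cube_y] i].
  split.
    have := cube_ty (lshift d ord0 : 'I_(1 + d)).
    by rewrite (row_mxEl (const_mx t : 'rV[R]_1)) mxE.
  move=> i; have := cube_ty (rshift 1 i : 'I_(1 + d)).
  by rewrite (row_mxEr (const_mx t : 'rV[R]_1)).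
rewrite -(splitK (i : 'I_(1 + d))); case: (fintype.split _) => j /=.
  by rewrite (row_mxEl (const_mx t : 'rV[R]_1)) mxE.
by rewrite (row_mxEr (const_mx t : 'rV[R]_1)).
Qed.

Lemma torus_intS (R : realType) (d : nat) (g : rfun R d.+1) :
  torus_int g =
    \int[lebesgue_measure]_(t in `[0%R, 1%R]) torus_int (slice g t).
Proof. by []. Qed.

Lemma torus_int_cst (R : realType) (d : nat) (c : R) :
  torus_int (fun _ : 'rV[R]_d => c) = c.
Proof.
elim: d => [//|d IHd]; rewrite torus_intS /slice IHd Rintegral_cst //=.
by rewrite lebesgue_measure_itv /= lte_fin ltr01 /= subr0 mulr1.
Qed.

Lemma integrable_continuous01 (R : realType) (f : R -> R) :
  continuous f -> lebesgue_measure.-integrable `[0, 1] (EFin \o f).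
Proof.
move=> fc; apply: continuous_compact_integrable; first exact: segment_compact.
exact: continuous_subspaceT.
Qed.

(* The induction hypothesis on d under which integrals over slices depend
   continuously on the slice, hence are integrable, so that it passes to d + 1. *)
Definition torus_int_linear_monotone (R : realType) (d : nat) : Prop :=
  (forall (c : R) (g h : rfun R d), continuous g -> continuous h ->
    torus_int (fun x => c * g x + h x) = c * torus_int g + torus_int h) /\
  (forall g h : rfun R d, continuous g -> continuous h ->
    (forall x, unit_cube x -> g x <= h x) -> torus_int g <= torus_int h).

Lemma continuous_lin_comb (R : realType) (d : nat) (c : R) (g h : rfun R d) :
  continuous g -> continuous h -> continuous (fun x => c * g x + h x).
Proof.
by move=> gc hc x; exact: (cvgD (cvgM (cvg_cst c) (gc x)) (hc x)).
Qed.

(** Monotonicity is applied to [g <= h + e] and to [h <= g + e]; the constant [e] integrates to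
    itself because the cube has volume 1. *)
Lemma torus_int_dist_le (R : realType) (d : nat) (g h : rfun R d) (e : R) :
  torus_int_linear_monotone R d -> continuous g -> continuous h ->
  (forall x, unit_cube x -> `|g x - h x| <= e) ->
  `|torus_int g - torus_int h| <= e.
Proof.
move=> [lin mono] gc hc gh.
have bound (u v : rfun R d) : continuous u -> continuous v ->
    (forall x, unit_cube x -> u x <= v x + e) ->
    torus_int u <= torus_int v + e.
  move=> uc vc uv; rewrite -[e](torus_int_cst d) -[torus_int v]mul1r -lin //.
    apply: mono => // [|x /uv]; last by rewrite mul1r.
    by apply: continuous_lin_comb => //; exact: cst_continuous.
  exact: cst_continuous.
have gh' : torus_int g <= torus_int h + e.
  by apply: bound => // x /gh; rewrite ler_norml => /andP[? ?]; lra.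
have hg' : torus_int h <= torus_int g + e.
  by apply: bound => // x /gh; rewrite ler_norml => /andP[? ?]; lra.
by rewrite ler_norml; apply/andP; split; lra.
Qed.

(* Pointwise joint convergence is uniform on the compact unit cube. *)
Lemma torus_int_cvg_aux (R : realType) (d : nat) (T : Type) (F : set_system T)
    (FF : Filter F) (G : T -> rfun R d) (g : rfun R d) :
  torus_int_linear_monotone R d -> (forall t, continuous (G t)) ->
  continuous g ->
  (forall y, (fun p : 'rV[R]_d * T => G p.2 p.1) @ filter_prod (nbhs y) F
     --> g y) ->
  (fun t => torus_int (G t)) @ F --> torus_int g.
Proof.
move=> LM Gc gc Gg; apply/cvgrPdist_le => e e0.
have /compact_near_coveringP cube_cover := @compact_unit_cube R d.
have : \forall t \near F,
    @unit_cube R d `<=` (fun y => `|g y - G t y| <= e).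
  apply: cube_cover => y _.
  have e20 : 0 < e / 2 by rewrite divr_gt0.
  have /cvgrPdist_le/(_ _ e20) Gy := Gg y.
  have /cvgrPdist_le/(_ _ e20) gy := gc y.
  have gy2 : \forall p \near filter_prod (nbhs y) F, `|g y - g p.1| <= e / 2.
    exact: (cvg_fst (F := nbhs y) (G := F) gy).
  near=> p; rewrite /=.
  have h1 : `|g y - G p.2 p.1| <= e / 2 by near: p.
  have h2 : `|g y - g p.1| <= e / 2 by near: p.
  move: h1 h2; rewrite !ler_norml => /andP[? ?] /andP[? ?].
  by apply/andP; split; lra.
apply: filterS => t cube_t; exact: torus_int_dist_le.
Unshelve. all: by end_near. Qed.

Lemma continuous_torus_int_slice_aux (R : realType) (d : nat)
    (g : rfun R d.+1) : torus_int_linear_monotone R d -> continuous g ->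
  continuous (fun t => torus_int (slice g t)).
Proof.
move=> LM gc t; apply: torus_int_cvg_aux => // [s|y|y].
- exact: continuous_slice.
- exact: continuous_slice.
- apply: (@cvg_comp _ _ _ (fun p => (p.2, p.1)) (fun p => slice g p.1 p.2)).
    exact: (cvg_pair cvg_snd cvg_fst).
  exact: (@continuous_uncurry_slice R d g gc (t, y)).
Qed.

Lemma torus_int_linear_monotoneP (R : realType) (d : nat) :
  torus_int_linear_monotone R d.
Proof.
elim: d => [|d LM].
  (* In dimension 0 the integral is the value at the only point, which lies in the cube
     vacuously. *)
  by split=> // g h _ _ gh; apply: gh => -[].
have [lin mono] := LM.
have integrable_slice (g : rfun R d.+1) : continuous g ->
    lebesgue_measure.-integrable `[0, 1]
      (EFin \o (fun t => torus_int (slice g t))).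
  by move=> gc; apply/integrable_continuous01/continuous_torus_int_slice_aux.
split=> [c g h gc hc|g h gc hc gh]; rewrite !torus_intS.
  rewrite -RintegralZl ?integrable_slice // -RintegralD //.
  - by apply: eq_Rintegral => t _; rewrite -lin //; exact: continuous_slice.
  - exact: (integrableZl _ c (integrable_slice _ gc)).
  - exact: integrable_slice.
apply: le_Rintegral; rewrite ?integrable_slice //= => t t01.
apply: mono => [||y cube_y]; [exact: continuous_slice..|].
by apply: gh; apply/unit_cube_row_mx.
Qed.
Lemma torus_int_lin (R : realType) (d : nat) (c : R) (g h : rfun R d) :
  continuous g -> continuous h ->
  torus_int (fun x => c * g x + h x) = c * torus_int g + torus_int h.
Proof. exact: (torus_int_linear_monotoneP R d).1. Qed.

Lemma torus_int_cvg (R : realType) (d : nat) (T : Type) (F : set_system T)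
    (FF : Filter F) (G : T -> rfun R d) (g : rfun R d) :
  (forall t, continuous (G t)) -> continuous g ->
  (forall y, (fun p : 'rV[R]_d * T => G p.2 p.1) @ filter_prod (nbhs y) F
     --> g y) ->
  (fun t => torus_int (G t)) @ F --> torus_int g.
Proof. exact: (torus_int_cvg_aux FF (@torus_int_linear_monotoneP R d)). Qed.

Lemma continuous_torus_int_slice (R : realType) (d : nat) (g : rfun R d.+1) :
  continuous g -> continuous (fun t => torus_int (slice g t)).
Proof.
exact: (continuous_torus_int_slice_aux (@torus_int_linear_monotoneP R d)).
Qed.

(** * Differentiation under the integral sign, and integrals of partial derivatives *)

Lemma row_mx_shift0 (R : realType) (d : nat) (h t : R) (y : 'rV[R]_d) :
  h *: delta_mx 0 ord0 + row_mx (const_mx t : 'rV[R]_1) y =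
    row_mx (const_mx (h + t) : 'rV[R]_1) y :> 'rV[R]_d.+1.
Proof.
apply/rowP => i; rewrite -(splitK (i : 'I_(1 + d))).
case: (fintype.split _) => j; rewrite !mxE unsplitK /= ?mxE.
  by rewrite ord1 [X in h * X]/= mulr1.
by rewrite mulr0 add0r.
Qed.

Lemma row_mx_shiftS (R : realType) (d : nat) (i : 'I_d) (h t : R)
    (y : 'rV[R]_d) :
  h *: delta_mx 0 (lift ord0 i) + row_mx (const_mx t : 'rV[R]_1) y =
    row_mx (const_mx t : 'rV[R]_1) (h *: delta_mx 0 i + y) :> 'rV[R]_d.+1.
Proof.
apply/rowP => k; rewrite -(splitK (k : 'I_(1 + d))).
case: (fintype.split _) => j; rewrite !mxE unsplitK /= ?mxE.
  by rewrite ord1 mulr0 add0r.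
by rewrite !eqxx /= -(inj_eq val_inj).
Qed.

(** The difference quotients coincide as functions of [h], so that derivability and the value of the
    derivative pass between [g] and its slices without a chain rule. *)
Lemma slice_quotient0 (R : realType) (d : nat) (g : rfun R d.+1) (t : R)
    (y : 'rV[R]_d) :
  (fun h => h^-1 *: ((g \o shift (row_mx (const_mx t : 'rV[R]_1) y))
                       (h *: delta_mx 0 ord0)
                     - g (row_mx (const_mx t : 'rV[R]_1) y))) =
  (fun h : R => h^-1 *: (((fun s => slice g s y) \o shift t) (h *: 1)
                     - slice g t y)).
Proof.
by apply/funext => h; rewrite /= row_mx_shift0 /slice [h *: 1]mulr1.
Qed.

Lemma slice_quotientS (R : realType) (d : nat) (i : 'I_d) (g : rfun R d.+1)
    (t : R) (y : 'rV[R]_d) :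
  (fun h => h^-1 *: ((g \o shift (row_mx (const_mx t : 'rV[R]_1) y))
                       (h *: delta_mx 0 (lift ord0 i))
                     - g (row_mx (const_mx t : 'rV[R]_1) y))) =
  (fun h : R => h^-1 *: ((slice g t \o shift y) (h *: delta_mx 0 i)
                     - slice g t y)).
Proof. by apply/funext => h; rewrite /= row_mx_shiftS. Qed.

Lemma pderiv_sliceS (R : realType) (d : nat) (i : 'I_d) (g : rfun R d.+1)
    (t : R) : slice (pderiv (lift ord0 i) g) t = pderiv i (slice g t).
Proof.
by apply/funext => y; rewrite /slice /pderiv /derive slice_quotientS.
Qed.

Lemma is_derive_slice0 (R : realType) (d : nat) (g : rfun R d.+1) (t : R)
    (y : 'rV[R]_d) :
  (forall x, derivable g x (delta_mx 0 ord0)) ->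
  is_derive t 1 (fun s => slice g s y) (slice (pderiv ord0 g) t y).
Proof.
move=> dg; split; last by rewrite /slice /pderiv /derive slice_quotient0.
have := dg (row_mx (const_mx t : 'rV[R]_1) y).
by rewrite /derivable slice_quotient0.
Qed.

(** The mean value theorem on the segment between [t] and [h + t]; both signs of [h] occur because
    the limit defining a derivative is two-sided. *)
Lemma slice_mean_value (R : realType) (d : nat) (g : rfun R d.+1) (t h : R)
    (y : 'rV[R]_d) :
  (forall x, derivable g x (delta_mx 0 ord0)) -> h != 0 ->
  exists2 c : R, `|c - t| <= `|h| &
    h^-1 * (slice g (h + t) y - slice g t y) = slice (pderiv ord0 g) c y.
Proof.
move=> dg h0.
have cs (i : interval R) :
    {within [set` i], continuous (fun s => slice g s y)}.
  apply: derivable_within_continuous => s _.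
  exact: (@ex_derive _ _ _ _ _ _ _ (is_derive_slice0 s y dg)).
have [h_gt0|h_le0] := ltP 0 h.
  have [|c] := @MVT_segment R (fun s => slice g s y)
      (fun s => slice (pderiv ord0 g) s y) t (h + t) _
      (fun s _ => is_derive_slice0 s y dg) (cs _).
    by lra.
  rewrite in_itv /= => /andP[tc ch] ->; exists c.
    by rewrite (gtr0_norm h_gt0) ger0_norm; lra.
  by rewrite addrK mulrCA mulVf ?mulr1.
have h_lt0 : h < 0 by rewrite lt_neqAle h0.
have [|c] := @MVT_segment R (fun s => slice g s y)
    (fun s => slice (pderiv ord0 g) s y) (h + t) t _
    (fun s _ => is_derive_slice0 s y dg) (cs _).
  by lra.
rewrite in_itv /= => /andP[tc ch] E; exists c.
  by rewrite (ltr0_norm h_lt0) ler0_norm; lra.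
have -> : slice g (h + t) y - slice g t y = slice (pderiv ord0 g) c y * h.
  by move: E; rewrite opprD; lra.
by rewrite mulrCA mulVf ?mulr1.
Qed.

(** By linearity the quotient of the integrals is the integral of the quotients [Q h]. By the mean
    value theorem these are values of [pderiv ord0 g] at points whose first coordinate is within
    [|h|] of [t], so that joint continuity gives the convergence that [torus_int_cvg] asks for. *)
Lemma is_derive_torus_int_slice (R : realType) (d : nat) (g : rfun R d.+1)
    (t : R) :
  continuous g -> (forall x, derivable g x (delta_mx 0 ord0)) ->
  continuous (pderiv ord0 g) ->
  is_derive t 1 (fun s => torus_int (slice g s))
    (torus_int (slice (pderiv ord0 g) t)).
Proof.
move=> gc dg dgc.
suff cv : (fun h : R => h^-1 *: (((fun s => torus_int (slice g s)) \o shift t)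
      (h *: 1) - torus_int (slice g t))) @ 0^'
    --> torus_int (slice (pderiv ord0 g) t).
  by split; [apply/cvg_ex; eexists; exact: cv|exact: cvg_lim cv].
pose Q (h : R) : rfun R d :=
  fun y => h^-1 * (slice g (h + t) y - slice g t y).
rewrite [X in X @ _](_ : _ = fun h => torus_int (Q h)); last first.
  apply/funext => h; rewrite /= [h *: 1]mulr1 /Q.
  rewrite (_ : (fun y => _) = (fun y => h^-1 * slice g (h + t) y
      + ((- h^-1) * slice g t y + 0))); last first.
    by apply/funext => y; rewrite addr0 mulrBr mulNr.
  have s0 : continuous (fun _ : 'rV[R]_d => 0 : R) by exact: cst_continuous.
  rewrite !torus_int_lin ?torus_int_cst //; try exact: continuous_slice.
    by rewrite addr0 mulNr -mulrBr.
  by apply: continuous_lin_comb => //; exact: continuous_slice.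
apply: torus_int_cvg => [h||y].
- rewrite /Q (_ : (fun y => _) = (fun y => h^-1 * slice g (h + t) y
      + ((- h^-1) * slice g t y + 0))); last first.
    by apply/funext => y; rewrite addr0 mulrBr mulNr.
  apply: continuous_lin_comb; first exact: continuous_slice.
  apply: continuous_lin_comb; first exact: continuous_slice.
  exact: cst_continuous.
- exact: continuous_slice.
apply/cvgrPdist_lt => e e0.
have /cvgrPdist_lt/(_ _ e0) := @continuous_uncurry_slice R d _ dgc (t, y).
case=> -[/= U V] [/nbhs_ballP[r /= r0 Ur] Vy] UV.
exists (V, [set h | h != 0 /\ `|h| < r]); first split=> //=.
  near=> h; split; first by near: h; exact: nbhs_dnbhs_neq.
  near: h; apply: dnbhs0_lt => //.
move=> -[y' h] /= [Vy' [h0 hr]].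
have [c ct] := slice_mean_value t y' dg h0; rewrite /Q => ->.
apply: (UV (c, y')); split=> //=; apply: Ur.
by rewrite /ball /= distrC; exact: le_lt_trans ct hr.
Unshelve. all: by end_near. Qed.

(** A derivative in a later coordinate acts inside each slice, where the induction hypothesis
    applies. For the first coordinate, the fundamental theorem of calculus gives [Phi 1 - Phi 0] for
    the slice integral [Phi], which is 0 by periodicity. *)
Lemma torus_int_pderiv (R : realType) (d : nat) (i : 'I_d) (g : rfun R d) :
  Defs.periodic g -> continuous g -> (forall x, derivable g x (delta_mx 0 i)) ->
  continuous (pderiv i g) -> torus_int (pderiv i g) = 0.
Proof.
elim: d i g => [[]//|d IHd] i g gp gc dg dgc; rewrite torus_intS.
have [j ij|i0] := unliftP ord0 i.
  rewrite (@eq_Rintegral _ _ _ _ _ (cst 0)) => [|t _].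
    by rewrite Rintegral_cst // mul0r.
  rewrite ij pderiv_sliceS IHd //.
  - move=> k y; rewrite /slice addrC -[delta_mx _ _]scale1r -row_mx_shiftS.
    by rewrite scale1r addrC gp.
  - exact: continuous_slice.
  - move=> y; have := dg (row_mx (const_mx t : 'rV[R]_1) y).
    by rewrite ij /derivable slice_quotientS.
  - by rewrite -pderiv_sliceS -ij; exact: continuous_slice.
rewrite {i}i0 in dg dgc *.
pose Phi := fun s => torus_int (slice g s).
have dPhi (t : R) : is_derive t 1 Phi (torus_int (slice (pderiv ord0 g) t)).
  exact: is_derive_torus_int_slice.
have Phic : continuous Phi by exact: continuous_torus_int_slice.
have Phi01 : Phi 1 = Phi 0.
  congr torus_int; apply/funext => y; rewrite /slice -[1]addr0 -row_mx_shift0.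
  by rewrite scale1r addrC gp.
rewrite /Rintegral (continuous_FTC2 (F := Phi)) ?ltr01 //.
- by rewrite Phi01 -EFinB subrr.
- exact/continuous_subspaceT/continuous_torus_int_slice.
- split=> [x _||].
  + exact: (@ex_derive _ _ _ _ _ _ _ (dPhi x)).
  + exact/cvg_at_right_filter/Phic.
  + exact/cvg_at_left_filter/Phic.
- move=> x _; rewrite derive1E; exact: derive_val.
Qed.
(** * Smooth functions on the torus *)

Lemma derivable_mul (R : realType) (d : nat) (g h : rfun R d) (x v : 'rV[R]_d) :
  derivable g x v -> derivable h x v -> derivable (fun y => g y * h y) x v.
Proof. exact: derivableM. Qed.

Lemma derivable_add (R : realType) (d : nat) (g h : rfun R d) (x v : 'rV[R]_d) :
  derivable g x v -> derivable h x v -> derivable (fun y => g y + h y) x v.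
Proof. exact: derivableD. Qed.

Lemma pderiv_mul (R : realType) (d : nat) (i : 'I_d) (g h : rfun R d) :
  (forall x, derivable g x (delta_mx 0 i)) ->
  (forall x, derivable h x (delta_mx 0 i)) ->
  pderiv i (fun x => g x * h x) =
    (fun x => g x * pderiv i h x + pderiv i g x * h x).
Proof.
move=> dg dh; apply/funext => x; rewrite /pderiv.
by rewrite (deriveM (dg x) (dh x)) [in RHS](mulrC _ (h x)).
Qed.

Lemma pderiv_add (R : realType) (d : nat) (i : 'I_d) (g h : rfun R d) :
  (forall x, derivable g x (delta_mx 0 i)) ->
  (forall x, derivable h x (delta_mx 0 i)) ->
  pderiv i (fun x => g x + h x) = (fun x => pderiv i g x + pderiv i h x).
Proof. by move=> dg dh; apply/funext => x; exact: deriveD. Qed.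

Lemma pderiv_cst (R : realType) (d : nat) (i : 'I_d) (c : R) :
  pderiv i (fun _ : 'rV[R]_d => c) = (fun=> 0).
Proof. by apply/funext => x; exact: derive_cst. Qed.

(** Smoothness speaks of all words of partial derivatives; a class stable under one derivative
    covers them by induction on the word, so that closure properties reduce to first-order
    calculus. *)
Lemma smooth_coind (R : realType) (d : nat) (P : rfun R d -> Prop) :
  (forall g, P g -> [/\ continuous g,
     forall i x, derivable g x (delta_mx 0 i) & forall i, P (pderiv i g)]) ->
  forall g, P g -> smooth g.
Proof.
move=> PP g Pg s; suff Ps : P (pderivs s g) by have [] := PP _ Ps.
by elim: s => [//|i s Ps]; have [_ _] := PP _ Ps; exact.
Qed.

Section SmoothTorus.
Context {R : realType} {d : nat}.
Implicit Types (g h : rfun R d) (i : 'I_d).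

Lemma smooth_continuous g : smooth g -> continuous g.
Proof. by move=> /(_ [::])[]. Qed.

Lemma smooth_derivable g i x : smooth g -> derivable g x (delta_mx 0 i).
Proof. by move=> /(_ [::])[]. Qed.

Lemma smooth_pderiv g i : smooth g -> smooth (pderiv i g).
Proof. by move=> gs s; have := gs (rcons s i); rewrite /pderivs foldr_rcons. Qed.

Lemma smooth_cst (c : R) : smooth (fun _ : 'rV[R]_d => c).
Proof.
apply: (@smooth_coind _ _ (fun g => exists c, g = fun=> c)); last by exists c.
move=> _ [a ->]; split=> [|i x|i].
- exact: cst_continuous.
- exact: derivable_cst.
- by exists 0; rewrite pderiv_cst.
Qed.

(* The Leibniz rule maps this span into itself. *)
Inductive product_span : rfun R d -> Prop :=
| product_span_mul g h :
    smooth g -> smooth h -> product_span (fun x => g x * h x)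
| product_span_add g h :
    product_span g -> product_span h -> product_span (fun x => g x + h x).

Lemma product_span_smooth g : product_span g -> smooth g.
Proof.
apply: smooth_coind => {}g; elim=> [{}g h gs hs|{}g h _ [gc dg gP] _ [hc dh hP]].
  split=> [x|i x|i].
  - have gc := smooth_continuous gs; have hc := smooth_continuous hs.
    exact: (cvgM (gc x) (hc x)).
  - by apply: derivable_mul; exact: smooth_derivable.
  - rewrite pderiv_mul; try by move=> x; exact: smooth_derivable.
    apply: product_span_add.
      exact: (product_span_mul gs (smooth_pderiv i hs)).
    exact: (product_span_mul (smooth_pderiv i gs) hs).
split=> [x|i x|i].
- exact: (cvgD (gc x) (hc x)).
- exact: derivable_add.
- by rewrite pderiv_add //; exact: product_span_add.
Qed.

Lemma smooth_mul g h : smooth g -> smooth h -> smooth (fun x => g x * h x).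
Proof.
by move=> gs hs; exact: (product_span_smooth (product_span_mul gs hs)).
Qed.

Lemma smooth_add g h : smooth g -> smooth h -> smooth (fun x => g x + h x).
Proof.
(* A single smooth function enters the span as the product [1 * u]. *)
have span u : smooth u -> product_span u.
  move=> us; rewrite -[u](_ : (fun x => 1 * u x) = u).
    exact: (product_span_mul (smooth_cst 1) us).
  by apply/funext => x; rewrite mul1r.
move=> gs hs.
exact: (product_span_smooth (product_span_add (span _ gs) (span _ hs))).
Qed.

Lemma smooth_torus_pderiv g i : smooth_torus g -> smooth_torus (pderiv i g).
Proof.
move=> [gp gs]; split; last exact: (smooth_pderiv i gs).
move=> j x; rewrite /pderiv /derive.
(* The difference quotients at the translated point are those at [x], by periodicity of [g]. *)
rewrite (_ : (fun s => _) = fun s : R => s^-1 *: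
  ((g \o shift x) (s *: delta_mx 0 i) - g x)) //.
by apply/funext => s; rewrite /= addrA !gp.
Qed.

Lemma smooth_torus_cst (c : R) : smooth_torus (fun _ : 'rV[R]_d => c).
Proof. by split=> //; exact: smooth_cst. Qed.

Lemma smooth_torus_mul g h :
  smooth_torus g -> smooth_torus h -> smooth_torus (fun x => g x * h x).
Proof.
move=> [gp gs] [hp hs]; split; last exact: (smooth_mul gs hs).
by move=> i x; rewrite gp hp.
Qed.

Lemma smooth_torus_add g h :
  smooth_torus g -> smooth_torus h -> smooth_torus (fun x => g x + h x).
Proof.
move=> [gp gs] [hp hs]; split; last exact: (smooth_add gs hs).
by move=> i x; rewrite gp hp.
Qed.

Lemma smooth_torus_scale (c : R) g :
  smooth_torus g -> smooth_torus (fun x => c * g x).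
Proof. exact: (smooth_torus_mul (smooth_torus_cst c)). Qed.

Lemma smooth_torus_opp g : smooth_torus g -> smooth_torus (fun x => - g x).
Proof.
move=> /(smooth_torus_scale (-1)); congr smooth_torus.
by apply/funext => x; rewrite mulN1r.
Qed.

Lemma smooth_torus_sum (I : Type) (r : seq I) (P : pred I)
    (F : I -> rfun R d) : (forall k, P k -> smooth_torus (F k)) ->
  smooth_torus (fun x => \sum_(k <- r | P k) F k x).
Proof.
move=> Fs; elim: r => [|k r IHr].
  by under eq_fun do rewrite big_nil; exact: smooth_torus_cst.
case Pk: (P k); last by under eq_fun do rewrite big_cons Pk.
under eq_fun do rewrite big_cons Pk.
exact: (smooth_torus_add (Fs k Pk)).
Qed.

Lemma pderivs_smooth_torus g (s : seq 'I_d) :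
  smooth_torus g -> smooth_torus (pderivs s g).
Proof.
move=> gs; elim: s => [|i s IHs]; first exact: gs.
exact: (smooth_torus_pderiv i IHs).
Qed.

Lemma smooth_torus_continuous g : smooth_torus g -> continuous g.
Proof. by move=> [_ /smooth_continuous]. Qed.

Lemma smooth_torus_derivable g i x :
  smooth_torus g -> derivable g x (delta_mx 0 i).
Proof. by move=> [_ /smooth_derivable]. Qed.

Lemma pderiv_sum (I : Type) (r : seq I) (P : pred I) (F : I -> rfun R d) i :
  (forall k, P k -> smooth_torus (F k)) ->
  pderiv i (fun x => \sum_(k <- r | P k) F k x) =
    (fun x => \sum_(k <- r | P k) pderiv i (F k) x).
Proof.
move=> Fs; elim: r => [|k r IHr].
  under eq_fun do rewrite big_nil; rewrite pderiv_cst.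
  by apply/funext => x; rewrite big_nil.
case Pk: (P k); under eq_fun do rewrite big_cons Pk;
  under [RHS]eq_fun do rewrite big_cons Pk; last exact: IHr.
rewrite pderiv_add ?IHr // => x.
- exact: smooth_torus_derivable (Fs k Pk).
- exact/smooth_torus_derivable/smooth_torus_sum.
Qed.

Lemma pderiv_scale (c : R) g i : smooth_torus g ->
  pderiv i (fun x => c * g x) = (fun x => c * pderiv i g x).
Proof.
move=> gs; rewrite pderiv_mul; first by rewrite pderiv_cst; under eq_fun do
  rewrite mul0r addr0.
- by move=> x; exact/smooth_torus_derivable/smooth_torus_cst.
- by move=> x; exact/smooth_torus_derivable.
Qed.

Lemma pderivs_lin_comb (I : Type) (r : seq I) (c : I -> R)
    (F : I -> rfun R d) (s : seq 'I_d) : (forall k, smooth_torus (F k)) ->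
  pderivs s (fun x => \sum_(k <- r) c k * F k x) =
    (fun x => \sum_(k <- r) c k * pderivs s (F k) x).
Proof.
move=> Fs; elim: s => //= i s ->; rewrite pderiv_sum => [|k _].
  apply/funext => x; apply: eq_bigr => k _; rewrite pderiv_scale //.
  exact: pderivs_smooth_torus.
exact/smooth_torus_scale/pderivs_smooth_torus.
Qed.

Lemma periodic_int g i (n : int) x : Defs.periodic g ->
  g (x + n%:~R *: delta_mx 0 i) = g x.
Proof.
move=> gp; have nat_period (k : nat) y : g (y + k%:R *: delta_mx 0 i) = g y.
  elim: k => [|k IHk]; first by rewrite scale0r addr0.
  by rewrite -natr1 scalerDl scale1r addrA gp IHk.
case: n => k; first exact: nat_period.
(* A negative shift is undone by the opposite positive one, which [nat_period] covers. *)
by rewrite NegzE mulrNz -[RHS](nat_period k.+1) scaleNr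
  -[LHS](nat_period k.+1) subrK nat_period.
Qed.

(** Subtracting its floor from each coordinate moves the point into the cube by integer periods. *)
Lemma periodic_unit_cube g x : Defs.periodic g ->
  exists2 y, unit_cube y & g y = g x.
Proof.
move=> gp.
exists (x + \sum_i (- Num.floor (x ord0 i))%:~R *: delta_mx 0 i).
  move=> i; rewrite mxE summxE (bigD1 i) //= big1 => [|j ji].
    rewrite !mxE !eqxx mulr1 addr0 in_itv /= mulrNz.
    have := floor_le_tmp (x ord0 i); have := floorD1_gt (x ord0 i).
    by rewrite intrD; lra.
  by rewrite !mxE /= eq_sym (negbTE ji) mulr0.
elim: (index_enum _) => [|i r IHr]; first by rewrite big_nil addr0.
by rewrite big_cons addrCA addrC periodic_int.
Qed.

(** The maximum over the compact cube bounds the function everywhere by periodicity. *)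
Lemma smooth_torus_bounded g : smooth_torus g ->
  exists M : R, forall x, `|g x| <= M.
Proof.
move=> [gp /smooth_continuous gc].
have [||z _ maxz] := @EVT_max_rV R d (fun x => `|g x|) (@unit_cube R d) _
    (@compact_unit_cube R d).
- by exists 0 => i; rewrite mxE in_itv /= lexx ler01.
- apply: continuous_subspaceT => x.
  exact: (continuous_comp (gc x) (@norm_continuous _ _ _)).
exists `|g z| => x; have [y cube_y <-] := periodic_unit_cube x gp.
by apply: maxz; rewrite inE.
Qed.

End SmoothTorus.

(** * Nonnegative continuous functions with zero integral *)

Lemma integral01_eq0 (R : realType) (f : R -> R) :
  continuous f -> (forall t, 0 <= f t) ->
  \int[lebesgue_measure]_(t in `[0%R, 1%R]) f t = 0 ->
  forall t, t \in `[0, 1] -> f t = 0.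
Proof.
move=> fc f0 If t t01; apply/eqP; rewrite eq_le f0 andbT leNgt; apply/negP => ft.
have ft2 : 0 < f t / 2 by rewrite divr_gt0.
have /cvgrPdist_lt/(_ _ ft2)/nbhs_ballP[r /= r0 fr] := fc t.
(* On this interval [f] is at least [f t / 2]. Clipping to [0, 1] leaves positive length even if [t]
   is an endpoint, and [r / 2] keeps the closed interval inside the open ball. *)
pose a := Num.max 0 (t - r / 2); pose b := Num.min 1 (t + r / 2).
move: (t01); rewrite in_itv /= => /andP[t0 t1].
have ab : a < b by rewrite /a /b lt_min !gt_max; apply/andP; split; lra.
have sub s : s \in `[a, b] -> s \in `[0, 1] /\ f t / 2 <= f s.
  rewrite !in_itv /= /a /b ge_max le_min => /andP[/andP[? ?] /andP[? ?]].
  split; first by apply/andP.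
  have /fr : ball t r s by rewrite /ball /= ltr_norml; lra.
  by rewrite /= ltr_norml; lra.
have If0 : (\int[lebesgue_measure]_(s in `[0%R, 1%R]) (f s)%:E = 0)%E.
  rewrite -[LHS]fineK; first by rewrite -/(Rintegral _ _ _) If.
  exact/integrable_fin_num/integrable_continuous01.
have fm := measurable_int _ (integrable_continuous01 fc).
have sub01 : `[a, b] `<=` (`[0, 1] : set R) by move=> s /= /sub[].
have : ((f t / 2 * (b - a))%:E <= 0)%E.
  rewrite -If0.
  apply: (@le_trans _ _ (\int[lebesgue_measure]_(s in `[a, b]) (f s)%:E)%E).
    rewrite (_ : (_ * _)%:E =
        (\int[lebesgue_measure]_(s in `[a, b]) (f t / 2)%:E)%E); last first.
      by rewrite integral_cst //= lebesgue_measure_itv /= lte_fin ab.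
    apply: ge0_le_integral => //.
    - by move=> s _; rewrite lee_fin ltW.
    - exact: measurable_funS fm.
    - by move=> s /= /sub[_]; rewrite lee_fin.
  by apply: ge0_subset_integral => // s _; rewrite lee_fin.
by rewrite lee_fin leNgt mulr_gt0 // subr_gt0.
Qed.

Lemma torus_int_ge0 (R : realType) (d : nat) (g : rfun R d) :
  (forall x, 0 <= g x) -> 0 <= torus_int g.
Proof.
elim: d g => [|d IHd] g g0; first exact: g0.
by apply: Rintegral_ge0 => t _; apply: IHd => y; exact: g0.
Qed.

(** The slice integrals are continuous and nonnegative with zero integral, so each of them vanishes
    and the induction hypothesis applies to every slice. *)
Lemma torus_int_eq0 (R : realType) (d : nat) (g : rfun R d) :
  continuous g -> (forall x, 0 <= g x) -> torus_int g = 0 ->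
  forall x, unit_cube x -> g x = 0.
Proof.
elim: d g => [|d IHd] g gc g0 Ig x cube_x.
  by rewrite -Ig /=; congr g; apply/rowP => -[].
have slice0 t : t \in `[0, 1] -> torus_int (slice g t) = 0.
  apply: (@integral01_eq0 R (fun s => torus_int (slice g s))) => [|s|].
  - exact: continuous_torus_int_slice.
  - by apply: torus_int_ge0 => y; exact: g0.
  - by rewrite -torus_intS.
pose x0 := x ord0 ord0; pose y := @rsubmx _ 1 1 d x.
have xE : x = row_mx (const_mx x0 : 'rV[R]_1) y.
  have -> : const_mx x0 = @lsubmx _ 1 1 d x.
    by apply/rowP => j; rewrite ord1 !mxE; congr (x _ _); exact: val_inj.
  by rewrite /y hsubmxK.
move: cube_x; rewrite xE => /unit_cube_row_mx[x001 cube_y].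
apply: (IHd (slice g x0)) => //; first exact: continuous_slice.
  by move=> z; exact: g0.
exact: slice0.
Qed.
(** * Adjoints *)

Section TorusInner.
Context {R : realType} {d : nat}.
Implicit Types (g h phi psi : rfun R d) (A B : operator R d).

Lemma torus_int_sum (I : Type) (r : seq I) (P : pred I) (F : I -> rfun R d) :
  (forall k, P k -> smooth_torus (F k)) ->
  torus_int (fun x => \sum_(k <- r | P k) F k x) =
    \sum_(k <- r | P k) torus_int (F k).
Proof.
move=> Fs; elim: r => [|k r IHr].
  by under eq_fun do rewrite big_nil; rewrite torus_int_cst big_nil.
rewrite big_cons; case Pk: (P k); under eq_fun do rewrite big_cons Pk;
  last exact: IHr.
rewrite -IHr -[X in X + _]mul1r -torus_int_lin.
- by under [in RHS]eq_fun do rewrite mul1r.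
- exact/smooth_torus_continuous/Fs.
- exact/smooth_torus_continuous/smooth_torus_sum.
Qed.

Lemma torus_int_scale (c : R) g : smooth_torus g ->
  torus_int (fun x => c * g x) = c * torus_int g.
Proof.
move=> gs; have gc := smooth_torus_continuous gs.
have := torus_int_lin c gc (@cst_continuous _ _ 0).
by rewrite torus_int_cst addr0 => <-; under [in RHS]eq_fun do rewrite addr0.
Qed.

Lemma innerC phi psi : inner phi psi = inner psi phi.
Proof. by congr torus_int; apply/funext => x; rewrite mulrC. Qed.

Lemma inner_lin_comb (I : Type) (r : seq I) (P : pred I) (c : I -> R)
    (F : I -> rfun R d) phi :
  smooth_torus phi -> (forall k, P k -> smooth_torus (F k)) ->
  inner phi (fun x => \sum_(k <- r | P k) c k * F k x) =
    \sum_(k <- r | P k) c k * inner phi (F k).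
Proof.
move=> phis Fs; rewrite /inner.
under eq_fun do rewrite mulr_sumr; rewrite torus_int_sum => [|k Pk].
  apply: eq_bigr => k Pk; under eq_fun do rewrite mulrCA.
  exact/torus_int_scale/smooth_torus_mul/Fs.
exact/smooth_torus_mul/smooth_torus_scale/Fs.
Qed.

(** Integration by parts: the derivative of the periodic function [phi * psi] has zero integral, and
    the Leibniz rule splits it. *)
Lemma inner_pderiv (i : 'I_d) phi psi : smooth_torus phi -> smooth_torus psi ->
  inner (pderiv i phi) psi = inner phi (fun x => - pderiv i psi x).
Proof.
move=> phis psis.
have dphi x : derivable phi x (delta_mx 0 i) by exact: smooth_torus_derivable.
have dpsi x : derivable psi x (delta_mx 0 i) by exact: smooth_torus_derivable.
have prods := smooth_torus_mul phis psis.
have := torus_int_pderiv prods.1 (smooth_torus_continuous prods)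
  (fun x => smooth_torus_derivable prods)
  (smooth_torus_continuous (smooth_torus_pderiv i prods)).
have s1 := smooth_torus_mul phis (smooth_torus_pderiv i psis).
have s2 := smooth_torus_mul (smooth_torus_pderiv i phis) psis.
rewrite pderiv_mul //; under eq_fun do rewrite -[X in X + _]mul1r.
rewrite torus_int_lin ?mul1r; try exact: smooth_torus_continuous.
move=> /eqP; rewrite addrC addr_eq0 => /eqP; rewrite -/(inner _ _) => ->.
rewrite -mulN1r -torus_int_scale //; congr torus_int.
by apply/funext => x; rewrite mulN1r mulrN.
Qed.

(** Testing against the difference [u] of the two functions shows that [u * u] has zero integral, so
    [u] vanishes on the cube and, by periodicity, everywhere. *)
Lemma inner_inj g h : smooth_torus g -> smooth_torus h ->
  (forall phi, smooth_torus phi -> inner phi g = inner phi h) -> g = h.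
Proof.
move=> gs hs gh; pose u := fun x => g x + - h x.
have us : smooth_torus u by exact/smooth_torus_add/smooth_torus_opp.
have uu0 : torus_int (fun x => u x * u x) = 0.
  have -> : (fun x => u x * u x) =
      (fun x => 1 * (u x * g x) + (-1) * (u x * h x)).
    by apply/funext => x; rewrite /u; ring.
  rewrite torus_int_lin; first last.
  - exact/smooth_torus_continuous/smooth_torus_scale/smooth_torus_mul.
  - exact/smooth_torus_continuous/smooth_torus_mul.
  rewrite torus_int_scale; last exact: smooth_torus_mul.
  by rewrite -/(inner u g) gh // mul1r mulN1r subrr.
have uus := smooth_torus_mul us us.
apply/funext => x; have [y cube_y] := periodic_unit_cube x uus.1.
have uu_ge0 z : 0 <= u z * u z by rewrite -expr2 sqr_ge0.
rewrite (torus_int_eq0 (smooth_torus_continuous uus) uu_ge0 uu0 cube_y).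
by move=> /esym/eqP; rewrite mulf_eq0 orbb subr_eq0 => /eqP.
Qed.

(** Adjoints are unique, so the choice made in [adjoint] can be replaced by any explicit
    candidate. *)
Lemma adjoint_eq B psi g : is_adjoint_at B psi g -> adjoint B psi = g.
Proof.
move=> Bg; have [gs gP] := Bg; have [As AP] := adjointP Bg.
by apply: inner_inj => // phi phis; rewrite -AP // gP.
Qed.

Lemma is_adjoint_at_lin_comb (I : Type) (r : seq I) (P : pred I) (c : I -> R)
    (A : I -> operator R d) psi (g : I -> rfun R d) :
  smooth_torus psi ->
  (forall k phi, P k -> smooth_torus phi -> smooth_torus (A k phi)) ->
  (forall k, P k -> is_adjoint_at (A k) psi (g k)) ->
  is_adjoint_at (fun phi x => \sum_(k <- r | P k) c k * A k phi x) psi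
    (fun x => \sum_(k <- r | P k) c k * g k x).
Proof.
move=> psis As Ag; split=> [|phi phis].
  by apply: smooth_torus_sum => k /Ag[gs _]; exact: smooth_torus_scale.
have gs k : P k -> smooth_torus (g k) by move=> /Ag[].
have Aphis k : P k -> smooth_torus (A k phi) by move=> Pk; exact: As Pk phis.
rewrite innerC (inner_lin_comb r c psis Aphis) (inner_lin_comb r c phis gs).
by apply: eq_bigr => k Pk; rewrite innerC ((Ag k Pk).2 phi phis).
Qed.

Lemma is_adjoint_at_lin_comb_r (I : Type) (r : seq I) (c : I -> R) A
    (psi g : I -> rfun R d) :
  (forall phi, smooth_torus phi -> smooth_torus (A phi)) ->
  (forall k, smooth_torus (psi k)) ->
  (forall k, is_adjoint_at A (psi k) (g k)) ->
  is_adjoint_at A (fun x => \sum_(k <- r) c k * psi k x)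
    (fun x => \sum_(k <- r) c k * g k x).
Proof.
move=> As psis Ag; split=> [|phi phis].
  by apply: smooth_torus_sum => k _; exact/smooth_torus_scale/(Ag k).1.
rewrite (inner_lin_comb (P := xpredT) r c (As _ phis) (fun k _ => psis k)).
rewrite (inner_lin_comb (P := xpredT) r c phis (fun k _ => (Ag k).1)).
by apply: eq_bigr => k _; rewrite ((Ag k).2 phi phis).
Qed.

Definition adjointable B : Prop :=
  (forall phi, smooth_torus phi -> smooth_torus (B phi)) /\
  (forall psi, smooth_torus psi -> exists g, is_adjoint_at B psi g).

Lemma adjointable_adjoint B psi : adjointable B -> smooth_torus psi ->
  is_adjoint_at B psi (adjoint B psi).
Proof. by move=> [_ BP] /BP[g /adjointP]. Qed.

(** The defining pairing tests smooth functions only. This lets an operator be replaced by an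
    expansion that is valid on smooth functions only. *)
Lemma eq_adjointable A B :
  (forall phi, smooth_torus phi -> A phi = B phi) ->
  adjointable A -> adjointable B.
Proof.
move=> AB [As AP]; split=> [phi phis|psi /AP[g [gs gP]]].
  by rewrite -(AB _ phis); exact: As phis.
exists g; split=> [|phi phis]; first exact: gs.
by rewrite -(AB _ phis) (gP _ phis).
Qed.

Lemma adjointable_idfun : adjointable idfun.
Proof. by split=> // psi psis; exists psi. Qed.

Lemma adjointable_comp A B :
  adjointable A -> adjointable B -> adjointable (A \o B).
Proof.
move=> [As AP] [Bs BP]; split=> [phi /Bs/As //|psi /AP[g [/BP[h [hs hP]] gP]]].
exists h; split=> [|phi phis]; first exact: hs.
by rewrite -(hP _ phis) -(gP _ (Bs _ phis)).
Qed.

Lemma adjointable_pderiv (i : 'I_d) : adjointable (pderiv i).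
Proof.
split=> [phi|psi psis]; first exact: smooth_torus_pderiv.
exists (fun x => - pderiv i psi x); split=> [|phi phis].
  exact/smooth_torus_opp/smooth_torus_pderiv.
exact: inner_pderiv.
Qed.

Lemma adjointable_pderivs (s : seq 'I_d) : adjointable (pderivs s).
Proof.
elim: s => [|i s IHs]; first exact: adjointable_idfun.
exact: adjointable_comp (adjointable_pderiv i) IHs.
Qed.

Lemma adjointable_mul g : smooth_torus g ->
  adjointable (fun phi x => g x * phi x).
Proof.
move=> gs; split=> [phi phis|psi psis]; first exact: smooth_torus_mul.
exists (fun x => g x * psi x); split=> [|phi phis]; first exact: smooth_torus_mul.
by congr torus_int; apply/funext => x; rewrite mulrCA mulrA.
Qed.

Lemma adjointable_lin_comb (I : Type) (r : seq I) (P : pred I) (c : I -> R)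
    (A : I -> operator R d) : (forall k, P k -> adjointable (A k)) ->
  adjointable (fun phi x => \sum_(k <- r | P k) c k * A k phi x).
Proof.
move=> AP; split=> [phi phis|psi psis].
  apply: smooth_torus_sum => k /AP[As _].
  exact/smooth_torus_scale/As.
exists (fun x => \sum_(k <- r | P k) c k * adjoint (A k) psi x).
exact: (is_adjoint_at_lin_comb r c psis (fun k phi Pk => (AP k Pk).1 phi)
  (fun k Pk => adjointable_adjoint (AP k Pk) psis)).
Qed.

Lemma adjointable_sum (I : Type) (r : seq I) (P : pred I)
    (A : I -> operator R d) : (forall k, P k -> adjointable (A k)) ->
  adjointable (fun phi x => \sum_(k <- r | P k) A k phi x).
Proof.
move=> /(@adjointable_lin_comb _ r P (fun=> 1)); apply: eq_adjointable => phi _.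
by apply/funext => x; apply: eq_bigr => k _; rewrite mul1r.
Qed.

Lemma adjointable_add A B : adjointable A -> adjointable B ->
  adjointable (fun phi x => A phi x + B phi x).
Proof.
(* A sum of two operators is treated as a sum over the two booleans. *)
move=> Aa Ba; have : forall b : bool, true -> adjointable (if b then A else B).
  by case.
move=> /(@adjointable_sum _ [:: true; false] xpredT).
apply: eq_adjointable => phi _; apply/funext => x.
by rewrite big_cons big_seq1.
Qed.

Lemma adjointable_scale (c : R) B : adjointable B ->
  adjointable (fun phi x => c * B phi x).
Proof. exact: (adjointable_comp (adjointable_mul (smooth_torus_cst c))). Qed.

(** Pair with the constant 1: the integral of [g] is [inner (fun=> 1) g], which is the pairing of
    [B 1 = 0] with [psi]. *)
Lemma torus_int_is_adjoint_at B psi g :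
  B (fun=> 1) = (fun=> 0) -> is_adjoint_at B psi g -> torus_int g = 0.
Proof.
move=> B1 [_ /(_ _ (smooth_torus_cst 1))]; rewrite B1 /inner.
under eq_fun do rewrite mul0r; rewrite torus_int_cst => ->.
by under [in RHS]eq_fun do rewrite mul1r.
Qed.

End TorusInner.

(** * The operators A_n and L_n *)

Section ModifiedOperators.
Context {R : realType} {d m : nat}.
Variables (f : 'I_d -> rfun R d) (sigma : 'I_d -> 'I_m -> rfun R d).
Hypothesis f_smooth : forall i, smooth_torus (f i).
Hypothesis sigma_smooth : forall i l, smooth_torus (sigma i l).

Lemma diffusion_smooth (i j : 'I_d) : smooth_torus (diffusion sigma i j).
Proof.
apply: smooth_torus_scale; apply: smooth_torus_sum => l _.
exact: smooth_torus_mul.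
Qed.

Lemma frozen_generator_expand : exists (I : finType) (c : I -> rfun R d)
    (s : I -> seq 'I_d),
  (forall k, smooth_torus (c k)) /\
  forall y phi x, frozen_generator f sigma y phi x =
    \sum_k c k y * pderivs (s k) phi x.
Proof.
exists ('I_d + 'I_d * 'I_d)%type.
exists (fun k => match k with
  | inl i => f i | inr ij => diffusion sigma ij.1 ij.2 end).
exists (fun k => match k with inl i => [:: i] | inr ij => [:: ij.1; ij.2] end).
split=> [[i|ij]|y phi x]; [exact: f_smooth|exact: diffusion_smooth|].
by rewrite /frozen_generator pair_big big_sumType.
Qed.

(** Coefficients frozen at [y] are constants for the derivatives in [x]: composition multiplies the
    coefficients and concatenates the words, without Leibniz terms. *)
Lemma iter_frozen_generator_expand (n : nat) : exists (I : finType)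
    (c : I -> rfun R d) (s : I -> seq 'I_d),
  (forall k, smooth_torus (c k)) /\
  forall y phi x, smooth_torus phi ->
    iter n (frozen_generator f sigma y) phi x =
      \sum_k c k y * pderivs (s k) phi x.
Proof.
have [J [a [w [a_smooth frozenE]]]] := frozen_generator_expand.
elim: n => [|n [I [c [s [c_smooth IHn]]]]].
  exists unit, (fun=> fun=> 1), (fun=> [::]); split=> [_|y phi x _].
    exact: smooth_torus_cst.
  by rewrite big_const card_unit /= addr0 mul1r.
exists (J * I)%type, (fun k y => a k.1 y * c k.2 y), (fun k => w k.1 ++ s k.2).
split=> [k|y phi x phis]; first exact: smooth_torus_mul.
rewrite iterS frozenE -(pair_bigA _ (fun j k =>
  a j y * c k y * pderivs (w j ++ s k) phi x)); apply: eq_bigr => j _ /=.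
have -> : iter n (frozen_generator f sigma y) phi =
    (fun z => \sum_k c k y * pderivs (s k) phi z).
  by apply/funext => z; exact: IHn.
rewrite pderivs_lin_comb => [|k]; last exact: pderivs_smooth_torus.
rewrite mulr_sumr; apply: eq_bigr => k _.
by rewrite mulrA /pderivs foldr_cat.
Qed.

(** On the diagonal [y = x] the expansion is a sum of partial derivatives followed by
    multiplications by smooth functions. *)
Lemma adjointable_euler_op (n : nat) : adjointable (euler_op f sigma n).
Proof.
have [I [c [s [c_smooth iterE]]]] := iter_frozen_generator_expand n.
apply: (@eq_adjointable _ _
  (fun phi x => n`!%:R^-1 * \sum_k c k x * pderivs (s k) phi x)).
  by move=> phi phis; apply/funext => x; rewrite /euler_op iterE.
apply/adjointable_scale/adjointable_sum => k _.
exact: adjointable_comp (adjointable_mul (c_smooth k))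
  (adjointable_pderivs (s k)).
Qed.

Definition kills_cst (B : operator R d) : Prop :=
  forall c : R, B (fun=> c) = (fun=> 0).

Lemma frozen_generator_cst (y : 'rV[R]_d) :
  kills_cst (frozen_generator f sigma y).
Proof.
move=> c; apply/funext => x; rewrite /frozen_generator !big1 ?addr0 // => i _.
  by rewrite big1 // => j _; rewrite !pderiv_cst mulr0.
by rewrite pderiv_cst mulr0.
Qed.

Lemma euler_opS_cst (n : nat) : kills_cst (euler_op f sigma n.+1).
Proof.
(* The innermost of the [n.+1] iterates already yields 0, and the other [n] preserve it. *)
move=> c; apply/funext => x; rewrite /euler_op iterSr frozen_generator_cst.
rewrite (_ : iter n _ _ = fun=> 0) ?mulr0 //.
by elim: n => //= n ->; exact: frozen_generator_cst.
Qed.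

Lemma generatorE : generator f sigma = euler_op f sigma 1.
Proof.
by apply/funext => phi; apply/funext => x; rewrite /euler_op invr1 mul1r.
Qed.

(** Makes the recursion well founded: the parts add up to [n - l], which is less than [n] because
    [l] is positive. *)
Lemma part_lt (l n : nat) (k : {ffun 'I_l.+1 -> 'I_n.+1}) (i : 'I_l.+1) :
  (0 < l < n.+1)%N -> (\sum_j k j = n - l)%N -> (k i < n)%N.
Proof.
move=> /andP[l0 ln] k_sum; apply: (@leq_ltn_trans (\sum_j k j)%N).
  by rewrite (bigD1 i) ?leq_addr.
by rewrite k_sum ltn_subrL l0 (leq_trans l0).
Qed.

Lemma adjointable_modified_step (B : nat -> R) (L : nat -> operator R d)
    (n : nat) :
  (forall k, (k < n)%N -> adjointable (L k)) ->
  adjointable (modified_step f sigma B L n).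
Proof.
move=> La; apply: adjointable_add; first exact: adjointable_euler_op.
pose S l : operator R d := fun phi x => \sum_(k : {ffun 'I_l.+1 -> 'I_n.+1} |
    (\sum_i k i == n - l)%N)
  compose_ops (fun i : 'I_l => L (k (widen_ord (leqnSn l) i)))
    (euler_op f sigma (k ord_max).+1 phi) x.
(* The range of [l] is repeated as a condition, to have it at hand for [part_lt] under the sum. *)
apply: (@eq_adjointable _ _ (fun phi x =>
  \sum_(1 <= l < n.+1 | (0 < l < n.+1)%N && true) B l / l`!%:R * S l phi x)).
  by move=> phi _; apply/funext => x; rewrite [RHS]big_nat_cond.
apply: adjointable_lin_comb => l; rewrite andbT => l0n.
apply: adjointable_sum => k /eqP k_sum.
apply: (@adjointable_comp _ _ (compose_ops _)); last exact: adjointable_euler_op.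
rewrite /compose_ops; apply: (big_ind adjointable) => [||i _].
- exact: adjointable_idfun.
- exact: adjointable_comp.
exact: La (part_lt _ l0n k_sum).
Qed.

(** Every [euler_op] here has positive index and is applied first, so that the factors [L k] only
    meet the zero function. *)
Lemma modified_step_cst (B : nat -> R) (L : nat -> operator R d) (n : nat) :
  (forall k, (k < n)%N -> L k (fun=> 0) = (fun=> 0)) ->
  kills_cst (modified_step f sigma B L n).
Proof.
move=> L0 c; apply/funext => x; rewrite /modified_step euler_opS_cst add0r.
rewrite big_nat_cond big1 // => l; rewrite andbT => l0n.
rewrite big1 ?mulr0 // => k /eqP k_sum; rewrite euler_opS_cst.
suff -> : compose_ops (fun i : 'I_l => L (k (widen_ord (leqnSn l) i))) (fun=> 0) =
    (fun=> 0) by [].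
rewrite /compose_ops.
apply: (big_ind (fun P : operator R d => P (fun=> 0) = fun=> 0));
  first by []; last move=> i _.
  by move=> P Q P0 Q0; rewrite /= Q0.
exact: L0 (part_lt _ l0n k_sum).
Qed.

Lemma adjointable_modified_op (B : nat -> R) (n : nat) :
  adjointable (modified_op f sigma B n).
Proof.
have [k] := ubnP n; elim: k n => [[]//|k IHk [|n] nk].
  by rewrite modified_op0 generatorE; exact: adjointable_euler_op.
rewrite (modified_opS f sigma B (ltn0Sn n)); apply: adjointable_modified_step => j jn.
exact/IHk/(leq_trans jn).
Qed.

Lemma modified_op_cst (B : nat -> R) (n : nat) :
  kills_cst (modified_op f sigma B n).
Proof.
have [k] := ubnP n; elim: k n => [[]//|k IHk [|n] nk].
  by rewrite modified_op0 generatorE; exact: euler_opS_cst.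
rewrite (modified_opS f sigma B (ltn0Sn n)); apply: modified_step_cst => j jn.
exact/IHk/(leq_trans jn).
Qed.

End ModifiedOperators.
(** * The expansion of the invariant density *)

(** Turns a multi-index into the word that repeats [i] exactly [j i] times. Its length is the order
    of the multi-index, so bounds over words of length at most [k] control [Cnorm k]. *)
Lemma mderivE (R : realType) (d : nat) (j : 'I_d -> nat) (g : rfun R d) :
  mderiv j g = pderivs (flatten [seq nseq (j i) i | i <- enum 'I_d]) g.
Proof.
rewrite /mderiv /pderivs; elim: (enum _) => //= i s ->.
by rewrite foldr_cat; elim: (j i) => //= n ->.
Qed.

Lemma size_mderiv (d : nat) (j : 'I_d -> nat) :
  size (flatten [seq nseq (j i) i | i <- enum 'I_d]) = (\sum_(i < d) j i)%N.
Proof.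
rewrite size_flatten /shape -map_comp sumnE big_map big_enum.
by apply: eq_bigr => i _; rewrite /= size_nseq.
Qed.

Lemma Cnorm_le (R : realType) (d k : nat) (g : rfun R d) (M : R) :
  (forall (s : seq 'I_d) x, (size s <= k)%N -> `|pderivs s g x| <= M) ->
  (Cnorm k g <= M%:E)%E.
Proof.
move=> gM; apply: ub_ereal_sup => _ [j [x [jk ->]]].
by rewrite lee_fin mderivE gM // size_mderiv.
Qed.

(** Induction on [k], peeling off the innermost derivative. There are finitely many directions, so
    the sum of their bounds, plus one for the empty word, serves for all words. *)
Lemma pderivs_bounded (R : realType) (d k : nat) (g : rfun R d) :
  smooth_torus g -> exists2 M : R, 0 <= M &
    forall (s : seq 'I_d) x, (size s <= k)%N -> `|pderivs s g x| <= M.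
Proof.
elim: k g => [|k IHk] g gs; have [M0 gM0] := smooth_torus_bounded gs.
  exists `|M0| => // -[|//] x _ /=.
  exact: le_trans (gM0 x) (ler_norm _).
have /choice[M MP] : forall i : 'I_d, exists M : R, 0 <= M /\
    forall (s : seq 'I_d) x, (size s <= k)%N -> `|pderivs s (pderiv i g) x| <= M.
  by move=> i; have [M ? ?] := IHk _ (smooth_torus_pderiv i gs); exists M.
have sum_ge0 (P : pred 'I_d) : 0 <= \sum_(i | P i) M i.
  by apply: sumr_ge0 => i _; have [] := MP i.
exists (`|M0| + \sum_i M i) => [|s x]; first exact: addr_ge0.
case/lastP: s => [|s i].
  move=> _ /=; apply: le_trans (gM0 x) _.
  by rewrite -[leLHS]addr0 lerD // ler_norm.
rewrite size_rcons ltnS => sk; rewrite /pderivs foldr_rcons.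
apply: le_trans ((MP i).2 s x sk) _; rewrite (bigD1 i) //= addrCA.
by rewrite lerDl addr_ge0.
Qed.

(** Reindexes the triangle [l + k <= N] by its diagonals [n = l + k], which collects the terms of
    equal order in tau. *)
Lemma sum_triangle (V : zmodType) (F : nat -> nat -> V) (N : nat) :
  \sum_(0 <= l < N.+1) \sum_(0 <= k < N.+1 - l) F l k =
    \sum_(0 <= n < N.+1) \sum_(0 <= l < n.+1) F l (n - l)%N.
Proof.
transitivity (\sum_(0 <= l < N.+1) \sum_(l <= n < N.+1) F l (n - l)%N).
  apply: eq_bigr => l _.
  rewrite [RHS](_ : _ = \sum_(0 + l <= n < N.+1) F l (n - l)%N) // big_addn.
  by apply: eq_bigr => k _; rewrite addnK.
elim: N => [|N IHN]; first by rewrite !big_nat1.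
rewrite big_nat_recr //= [RHS]big_nat_recr //= -IHN big_nat1.
rewrite [X in _ = _ + X]big_nat_recr //= addrA; congr (_ + _).
rewrite -big_split /=; apply: eq_big_nat => l /andP[_ lN].
by rewrite big_nat_recr // ltnW.
Qed.

(** * Recursive construction of the densities *)

Section InvariantExpansion.
Context {R : realType} {d m : nat}.
Variables (f : 'I_d -> rfun R d) (sigma : 'I_d -> 'I_m -> rfun R d).
Hypothesis f_smooth : forall i, smooth_torus (f i).
Hypothesis sigma_smooth : forall i l, smooth_torus (sigma i l).
Variables (B : nat -> R) (rho : rfun R d).
Hypothesis hyp1 : H1 f sigma rho.
Hypothesis hyp2 : H2 f sigma rho.

Local Notation L := (modified_op f sigma B).

Let L_adj n : adjointable (L n).
Proof. exact: adjointable_modified_op. Qed.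

Definition density_rhs (mu : nat -> rfun R d) (n : nat) : rfun R d :=
  fun x => - \sum_(1 <= l < n.+1) adjoint (L l) (mu (n - l)%N) x.

Lemma density_rhs_smooth (mu : nat -> rfun R d) (n : nat) :
  (forall k, (k < n)%N -> smooth_torus (mu k)) ->
  smooth_torus (density_rhs mu n) /\ torus_int (density_rhs mu n) = 0.
Proof.
move=> mus.
have adj_at l : (0 < l < n.+1)%N -> is_adjoint_at (L l) (mu (n - l)%N)
    (adjoint (L l) (mu (n - l)%N)).
  move=> /andP[l0 ln]; apply: adjointable_adjoint => //; apply: mus.
  by rewrite ltn_subrL l0 (leq_trans l0).
have -> : density_rhs mu n = fun x => \sum_(1 <= l < n.+1 | (0 < l < n.+1)%N)
    (-1) * adjoint (L l) (mu (n - l)%N) x.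
  apply/funext => x; rewrite /density_rhs -sumrN big_nat_cond.
  by apply: eq_big => [l|l _]; rewrite ?andbT // mulN1r.
split.
  by apply: smooth_torus_sum => l /adj_at[? _]; exact: smooth_torus_scale.
rewrite torus_int_sum => [|l /adj_at[? _]]; last exact: smooth_torus_scale.
rewrite big1 // => l /adj_at adjl; rewrite torus_int_scale; last exact: adjl.1.
by rewrite (torus_int_is_adjoint_at _ adjl) ?mulr0 // modified_op_cst.
Qed.

(** The default value would occur only without a solution, which [next_densityP] excludes when the
    earlier functions are smooth. *)
Definition next_density (mu : nat -> rfun R d) (n : nat) : rfun R d :=
  xget (fun=> 0) [set nu : rfun R d | [/\ smooth_torus nu,
    adjoint (L 0) nu = density_rhs mu n & torus_int nu = 0]].

Lemma next_densityP (mu : nat -> rfun R d) (n : nat) :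
  (forall k, (k < n)%N -> smooth_torus (mu k)) ->
  [/\ smooth_torus (next_density mu n),
    adjoint (L 0) (next_density mu n) = density_rhs mu n &
    torus_int (next_density mu n) = 0].
Proof.
move=> mus; have [rs r0] := density_rhs_smooth mus.
pose P := [set nu : rfun R d | [/\ smooth_torus nu,
  adjoint (L 0) nu = density_rhs mu n & torus_int nu = 0]].
apply: (@xgetPex _ (fun=> 0) P).
have [rhos rho0 Lrho rho1] := hyp1.
have [nu [[nus Lnu _] _]] := hyp2 rs r0.
(* H2 normalises [nu] against [rho] and not against 1. Since [rho] has integral 1 and is annihilated
   by the adjoint generator, adding [c * rho] corrects the mean and keeps the equation. *)
pose c := - torus_int nu.
exists (fun x => c * rho x + nu x).
have cs : smooth_torus (fun x => c * rho x + nu x).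
  exact/smooth_torus_add/nus/smooth_torus_scale.
split=> //; last first.
  rewrite torus_int_lin; [|exact: smooth_torus_continuous..].
  by rewrite rho1 mulr1 addNr.
have As := (L_adj 0).1.
pose e (b : bool) := if b then rho else nu.
pose a (b : bool) : R := if b then c else 1.
have := @is_adjoint_at_lin_comb_r _ _ _ [:: true; false] a (L 0) e
  (fun b => adjoint (L 0) (e b)) As.
have -> : (fun x => \sum_(b <- [:: true; false]) a b * e b x) =
    (fun x => c * rho x + nu x).
  by apply/funext => x; rewrite big_cons big_seq1 mul1r.
have es b : smooth_torus (e b) by case: b; [exact: rhos|exact: nus].
move=> /(_ es (fun b => adjointable_adjoint (L_adj 0) (es b)))/adjoint_eq ->.
apply/funext => x; rewrite big_cons big_seq1 /= modified_op0 Lrho Lnu.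
by rewrite mulr0 add0r mul1r.
Qed.

(** Course-of-values recursion: the right-hand side at [n] involves all earlier functions, hence the
    whole list. *)
Fixpoint densities (n : nat) : seq (rfun R d) :=
  if n is n'.+1 then
    let s := densities n' in rcons s (next_density (nth (fun=> 0) s) n)
  else [:: rho].

Definition density (n : nat) : rfun R d := nth (fun=> 0) (densities n) n.

Lemma size_densities n : size (densities n) = n.+1.
Proof. by elim: n => //= n IHn; rewrite size_rcons IHn. Qed.

Lemma nth_densities n k : (k <= n)%N ->
  nth (fun=> 0) (densities n) k = density k.
Proof.
elim: n => [|n IHn]; first by rewrite leqn0 => /eqP ->.
rewrite leq_eqVlt => /predU1P[-> //|kn].
by rewrite /= nth_rcons size_densities kn IHn.
Qed.

Lemma densityS n : density n.+1 = next_density density n.+1.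
Proof.
rewrite {1}/density /= nth_rcons size_densities ltnn eqxx.
rewrite /next_density; suff -> : density_rhs (nth (fun=> 0) (densities n)) n.+1 =
  density_rhs density n.+1 by [].
(* The sum starts at [l = 1], so it only looks up entries below [n.+1], where the list and the
   sequence agree. *)
apply/funext => x; congr (- _); apply: eq_big_nat => l /andP[l0 _].
by rewrite nth_densities //; case: l l0 => // l _; rewrite subSS leq_subr.
Qed.

Lemma density_smooth n : smooth_torus (density n).
Proof.
have [k] := ubnP n; elim: k n => // k IHk [|n] nk; first by have [] := hyp1.
have mus j : (j < n.+1)%N -> smooth_torus (density j).
  by move=> jn; exact/IHk/(leq_trans jn).
by rewrite densityS; have [] := next_densityP mus.
Qed.

Lemma densityP n : [/\ smooth_torus (density n.+1),
  adjoint (L 0) (density n.+1) = density_rhs density n.+1 &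
  torus_int (density n.+1) = 0].
Proof.
by rewrite densityS; apply: next_densityP => k _; exact: density_smooth.
Qed.

Lemma adjoint_density n x :
  adjoint (L 0) (density n) x = density_rhs density n x.
Proof.
case: n => [|n]; last by have [_ ->] := densityP n.
rewrite /density_rhs big_geq // oppr0 modified_op0.
by have [_ _ -> _] := hyp1.
Qed.

(** The coefficient of tau^n in the product of the two formal series; the term [l = 0] cancels the
    others by the recursion. *)
Lemma sum_adjoint_density n x :
  \sum_(0 <= l < n.+1) adjoint (L l) (density (n - l)%N) x = 0.
Proof.
by rewrite big_ltn // subn0 adjoint_density /density_rhs addNr.
Qed.

(** * The truncated operator and density, and the remainder *)

Lemma truncated_opE N tau : truncated_op f sigma B N tau =
  fun phi x => \sum_(0 <= l < N.+1) tau ^+ l * L l phi x.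
Proof.
apply/funext => phi; apply/funext => x; rewrite [RHS]big_ltn // expr0 mul1r.
by rewrite modified_op0.
Qed.

Lemma truncated_densityE N tau : truncated_density rho density N tau =
  fun x => \sum_(0 <= l < N.+1) tau ^+ l * density l x.
Proof. by apply/funext => x; rewrite [RHS]big_ltn // expr0 mul1r. Qed.

Lemma truncated_density_smooth N tau :
  smooth_torus (truncated_density rho density N tau).
Proof.
rewrite truncated_densityE; apply: smooth_torus_sum => l _.
exact/smooth_torus_scale/density_smooth.
Qed.

Lemma torus_int_truncated_density N tau :
  torus_int (truncated_density rho density N tau) = 1.
Proof.
have ds l : smooth_torus (fun x => tau ^+ l * density l x).
  exact/smooth_torus_scale/density_smooth.
rewrite truncated_densityE torus_int_sum // big_ltn // big_nat_cond.
have [_ _ _ rho1] := hyp1.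
rewrite torus_int_scale; last exact: density_smooth.
rewrite expr0 mul1r rho1 big1 ?addr0 // => -[//|l] _.
rewrite torus_int_scale; last exact: density_smooth.
by have [_ _ ->] := densityP l; rewrite mulr0.
Qed.

Lemma adjointable_truncated_op N tau :
  adjointable (truncated_op f sigma B N tau).
Proof. by rewrite truncated_opE; exact: adjointable_lin_comb. Qed.

(** Expanding bilinearly gives all pairs with [l, k <= N]; those with [l + k <= N] cancel order by
    order. *)
Lemma adjoint_truncated N tau :
  adjoint (truncated_op f sigma B N tau) (truncated_density rho density N tau) =
  fun x => \sum_(0 <= l < N.+1) tau ^+ l *
    \sum_(N.+1 - l <= k < N.+1) tau ^+ k * adjoint (L l) (density k) x.
Proof.
rewrite truncated_opE truncated_densityE.
have is_adj l : is_adjoint_at (L l)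
    (fun x => \sum_(0 <= k < N.+1) tau ^+ k * density k x)
    (fun x => \sum_(0 <= k < N.+1) tau ^+ k * adjoint (L l) (density k) x).
  apply: is_adjoint_at_lin_comb_r => [|k|k].
  - exact: (L_adj l).1.
  - exact: density_smooth.
  - exact/adjointable_adjoint/density_smooth.
have sum_smooth :
    smooth_torus (fun x => \sum_(0 <= k < N.+1) tau ^+ k * density k x).
  by rewrite -truncated_densityE; exact: truncated_density_smooth.
rewrite (adjoint_eq (is_adjoint_at_lin_comb (P := xpredT) (index_iota 0 N.+1)
  (fun l => tau ^+ l) sum_smooth (fun l phi _ => (L_adj l).1 phi)
  (fun l _ => is_adj l))).
apply/funext => x.
(* The zero added here is the triangle [l + k <= N]; in each row [l] it completes the range of [k]
   to 0, ..., N. *)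
rewrite -[RHS]add0r -[X in X + _](_ : \sum_(0 <= l < N.+1) tau ^+ l *
    \sum_(0 <= k < N.+1 - l) tau ^+ k * adjoint (L l) (density k) x = 0).
  rewrite -big_split /=; apply: eq_bigr => l _.
  by rewrite -mulrDr -big_cat_nat //= leq_subr.
under eq_bigr do rewrite mulr_sumr.
rewrite (sum_triangle (fun l k =>
  tau ^+ l * (tau ^+ k * adjoint (L l) (density k) x))).
rewrite big1 // => n _.
(* On a diagonal the powers multiply to [tau ^+ n], and [sum_adjoint_density] annihilates the
   rest. *)
rewrite (eq_big_nat _ _
  (F2 := fun l => tau ^+ n * adjoint (L l) (density (n - l)%N) x)).
  by rewrite -mulr_sumr sum_adjoint_density mulr0.
by move=> l /andP[_ ln]; rewrite mulrA -exprD subnKC.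
Qed.

Lemma torus_int_adjoint_truncated N tau :
  torus_int (adjoint (truncated_op f sigma B N tau)
    (truncated_density rho density N tau)) = 0.
Proof.
apply: torus_int_is_adjoint_at (adjointable_adjoint
  (adjointable_truncated_op N tau) (truncated_density_smooth N tau)).
rewrite truncated_opE; apply/funext => x.
by rewrite big1 // => l _; rewrite modified_op_cst ?mulr0.
Qed.

Lemma Cnorm_adjoint_truncated N k (tau0 : R) : exists C : R,
  forall tau, 0 <= tau <= tau0 ->
    (Cnorm k (adjoint (truncated_op f sigma B N tau)
       (truncated_density rho density N tau)) <= (C * tau ^+ N.+1)%:E)%E.
Proof.
have adj_smooth l n : smooth_torus (adjoint (L l) (density n)).
  by have [] := adjointable_adjoint (L_adj l) (density_smooth n).
have /choice[M MP] : forall p : nat * nat, exists M : R, 0 <= M /\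
    forall (s : seq 'I_d) x, (size s <= k)%N ->
      `|pderivs s (adjoint (L p.1) (density p.2)) x| <= M.
  by move=> p; have [M ? ?] := pderivs_bounded k (adj_smooth p.1 p.2); exists M.
(* A surviving power splits as [tau ^+ (l + n - N.+1) * tau ^+ N.+1], whose first factor is at most
   the same power of [tau0]; [M (l, n)] bounds the derivatives of the function it multiplies. *)
exists (\sum_(0 <= l < N.+1) \sum_(N.+1 - l <= n < N.+1)
  tau0 ^+ (l + n - N.+1) * M (l, n)).
move=> tau /andP[tau_ge0 tau_le]; apply: Cnorm_le => s x sk.
rewrite adjoint_truncated pderivs_lin_comb => [|l]; last first.
  by apply: smooth_torus_sum => n _; exact: smooth_torus_scale.
rewrite mulr_suml; apply: le_trans (ler_norm_sum _ _ _) _.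
apply: ler_sum => l _; rewrite pderivs_lin_comb // mulr_sumr mulr_suml.
apply: le_trans (ler_norm_sum _ _ _) _; apply: ler_sum_nat => n /andP[Nln _].
have Nln' : (N.+1 <= l + n)%N by rewrite -leq_subLR.
rewrite mulrA -exprD normrM (ger0_norm (exprn_ge0 _ tau_ge0)).
rewrite -{1}(subnK Nln') exprD mulrAC; apply: ler_wpM2r; first exact: exprn_ge0.
apply: ler_pM => //; first exact: exprn_ge0.
  by apply: lerXn2r; rewrite ?nnegrE // (le_trans tau_ge0).
exact: (MP (l, n)).2.
Qed.

End InvariantExpansion.
Theorem proposition5p1 (R : realType) (d m : nat)
    (f : 'I_d -> rfun R d) (sigma : 'I_d -> 'I_m -> rfun R d)
    (f_smooth : forall i, smooth_torus (f i))
    (sigma_smooth : forall i l, smooth_torus (sigma i l))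
    (B : nat -> R) (B_bernoulli : bernoulli_numbers B)
    (rho : rfun R d)
    (hyp1 : H1 f sigma rho) (hyp2 : H2 f sigma rho) (hyp3 : H3 f sigma rho) :
  exists mu : nat -> rfun R d,
    [/\ forall n, smooth_torus (mu n),
        mu 0%N = rho,
        forall n, (1 <= n)%N -> torus_int (mu n) = 0,
        forall n x, adjoint (modified_op f sigma B 0) (mu n) x =
          - \sum_(1 <= l < n.+1)
              adjoint (modified_op f sigma B l) (mu (n - l)%N) x &
        forall (N : nat) (tau0 : R), 0 < tau0 ->
          let G tau := adjoint (truncated_op f sigma B N tau)
                               (truncated_density rho mu N tau) in
          [/\ forall tau, 0 <= tau <= tau0 ->
                smooth_torus (truncated_density rho mu N tau) /\
                torus_int (truncated_density rho mu N tau) = 1,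
              forall k, exists C : R, forall tau, 0 <= tau <= tau0 ->
                (Cnorm k (G tau) <= (C * tau ^+ N.+1)%:E)%E &
              forall tau, 0 <= tau <= tau0 -> torus_int (G tau) = 0]].
Proof.
exists (density f sigma B rho); split.
- exact: density_smooth.
- by [].
- by move=> [//|n] _; have [] := densityP f_smooth sigma_smooth B hyp1 hyp2 n.
- exact: adjoint_density.
move=> N tau0 tau0_gt0 G; split=> [tau _|k|tau _].
- by split; [exact: truncated_density_smooth|exact: torus_int_truncated_density].
- exact: Cnorm_adjoint_truncated.
- exact: torus_int_adjoint_truncated.
Qed.
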